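(* Consider the equilibrium of the $n$-firm economy as a function of the climate belief of a single firm, all other parameters being fixed, for that belief ranging over an interval $J\subseteq(0,\infty)$ of regime-preserving perturbations (see context). Let $k_i=r_iq_i$ and $q_i$ be the equilibrium carbon emission and production quantity of any firm $i$. (a) As functions of firm $i$'s own belief $\alpha_i^2\in J$: (i) $k_i$ is weakly decreasing. The decrease is strict unless $i$ is green. (ii) $q_i$ is weakly decreasing. The decrease is strict as long as $i$ is not green and red firms exist in the economy. (b) As functions of the belief $\alpha_j^2\in J$ of a second firm $j\ne i$: (i) If $j$ is green, its belief does not affect other firms: $k_i$ and $q_i$ are constant on $J$. (ii) If $j$ is orange and $i$ is red, the dependence of $k_i$ and $q_i$ on $\alpha_j^2$ is ambiguous: there are economies in which $k_i$ and $q_i$ are strictly increasing in $\alpha_j^2$ and economies in which they are strictly decreasing in $\alpha_j^2$, depending on the other firms. In the remaining cases (i.e., $j$ is not green, and it is not the case that $j$ is orange and $i$ is red): (iii) $k_i$ is weakly increasing in $\alpha_j^2$, and strictly increasing unless $i$ is green. (iv) $q_i$ is strictly increasing in $\alpha_j^2$ if $j$ is red, but weakly decreasing in $\alpha_j^2$ if $j$ is orange; in the latter case the decrease is strict unless there are no red firms.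
   Context: Model. There are $n\ge1$ firms; constants $A,b,c,d>0$ and $K_{ex}\ge0$ are given. Firm $i$ chooses a technology $r_i\in[0,1]$ and a quantity $q_i\in[0,\infty)$; its carbon emission is $k_i=r_iq_i$. The convention $r_i=0$ is imposed whenever $q_i=0$. The number $\alpha_i^2=E_i[\alpha^2]$ (a symbol for a nonnegative real, the second moment of a random variable $\alpha$ under firm $i$'s subjective belief) is called the climate belief of firm $i$. Put $Q=\sum_j q_j$, $K=K_{ex}+\sum_j r_jq_j$, $Q_{-i}=Q-q_i$, $K_{-i}=K-k_i$. The expected profit of firm $i$ for a choice $(r,q)\in[0,1]\times[0,\infty)$ is $$(A-q-Q_{-i})^+\,q-b\alpha_i^2\,(rq+K_{-i})\,rq-(c+d-dr)\,q .$$ An equilibrium (Nash) is a profile $(r_j,q_j)_{1\le j\le n}$ such that for every $i$, $(r_i,q_i)$ maximizes firm $i$'s expected profit over $[0,1]\times[0,\infty)$ given $Q_{-i}=\sum_{j\ne i}q_j$ and $K_{-i}=K_{ex}+\sum_{j\ne i}r_jq_j$. For all parameters there is a unique equilibrium. Colors (in equilibrium). Firm $i$ is white if $q_i=0$; green if $q_i>0$ and $r_i=0$; orange if $q_i>0$ and $0<r_i<1$; red if $q_i>0$ and $r_i=1$. Standing assumptions. All climate beliefs are strictly positive, $\alpha_i^2>0$, and there are no white firms. Only regime-preserving perturbations are considered: if the belief $\alpha_l^2$ of firm $l$ is the one being varied, $J\subseteq(0,\infty)$ is a nondegenerate interval such that for all $\alpha_l^2\in J$ (other parameters fixed) the equilibrium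 has no white firm, and the color of every firm is constant for $\alpha_l^2$ in the interior of $J$. ''Firm $i$ is green/orange/red'' refers to this constant color. *)

(* Defs.v *)
From HB Require Import structures.
From mathcomp Require Import all_boot all_order all_algebra.
From mathcomp Require Import all_classical all_reals all_analysis.

Set Implicit Arguments.
Unset Strict Implicit.
Unset Printing Implicit Defensive.

Import Order.TTheory GRing.Theory Num.Theory.
Import numFieldNormedType.Exports.

Local Open Scope classical_set_scope.
Local Open Scope ring_scope.

(* The constants [A], [b], [c], [d] and [K_ex] shared by all firms. *)
Record market (R : realType) := Market {
  mkA : R; mkb : R; mkc : R; mkd : R; mkKex : R;
  mkA_gt0 : 0 < mkA;
  mkb_gt0 : 0 < mkb;
  mkc_gt0 : 0 < mkc;
  mkd_gt0 : 0 < mkd;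
  mkKex_ge0 : 0 <= mkKex }.

(* Expected profit of a firm with climate belief [a] (that is, alpha_i^2) which
   chooses technology [r] and quantity [q], when the other firms produce [Qm]
   in total and all emissions other than its own amount to [Km]. *)
Definition profit (R : realType) (M : market R) (a Qm Km r q : R) : R :=
  Num.max (mkA M - q - Qm) 0 * q
  - mkb M * a * (r * q + Km) * (r * q)
  - (mkc M + mkd M - mkd M * r) * q.

Definition others_quantity (R : realType) (n : nat) (q : 'I_n -> R) (i : 'I_n)
    : R :=
  \sum_(j < n | j != i) q j.

(* Includes the external emissions. *)
Definition others_emission (R : realType) (M : market R) (n : nat)
    (r q : 'I_n -> R) (i : 'I_n) : R :=
  mkKex M + \sum_(j < n | j != i) r j * q j.

(* [alpha i] stands for the climate belief alpha_i^2. *)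
Definition equilibrium (R : realType) (M : market R) (n : nat)
    (alpha : 'I_n -> R) (r q : 'I_n -> R) : Prop :=
  forall i : 'I_n,
    [/\ 0 <= r i <= 1,
        0 <= q i,
        q i = 0 -> r i = 0
      & forall r' q' : R, 0 <= r' <= 1 -> 0 <= q' ->
          profit M (alpha i) (others_quantity q i) (others_emission M r q i)
            r' q'
          <= profit M (alpha i) (others_quantity q i) (others_emission M r q i)
               (r i) (q i)].

Inductive color := white | green | orange | red.

Definition has_color (R : realType) (k : color) (r q : R) : Prop :=
  match k with
  | white => q = 0
  | green => 0 < q /\ r = 0
  | orange => 0 < q /\ 0 < r < 1
  | red => 0 < q /\ r = 1
  end.

(* [r x] and [q x] form the equilibrium when the belief of firm [l] is [x] and
   all other beliefs are given by [alpha]; the value [alpha l] is irrelevant.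
   [col] gives the constant colors of the firms; at the end points of [J] that
   belong to [J] a firm may have another color. *)
Record regime_preserving (R : realType) (M : market R) (n : nat)
    (alpha : 'I_n -> R) (l : 'I_n) (J : set R)
    (r q : R -> 'I_n -> R) (col : 'I_n -> color) : Prop := RegimePreserving {
  rp_belief_gt0 : forall m, 0 < alpha m;
  rp_interval : is_interval J;
  rp_nondegenerate : exists x y, [/\ J x, J y & x < y];
  rp_gt0 : forall x, J x -> 0 < x;
  rp_equilibrium : forall x, J x ->
    equilibrium M [eta alpha with l |-> x] (r x) (q x);
  rp_no_white : forall x m, J x -> ~ has_color white (r x m) (q x m);
  rp_color : forall (x : R) m, J° x -> has_color (col m) (r x m) (q x m) }.

Definition emission (R : realType) (n : nat) (r q : R -> 'I_n -> R)
    (i : 'I_n) (x : R) : R := r x i * q x i.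

Definition quantity (R : realType) (n : nat) (q : R -> 'I_n -> R)
    (i : 'I_n) (x : R) : R := q x i.

Definition weakly_increasing_on (R : realType) (J : set R) (f : R -> R) :=
  {in J &, {homo f : x y / x <= y}}.

Definition strictly_increasing_on (R : realType) (J : set R) (f : R -> R) :=
  {in J &, {homo f : x y / x < y}}.

Definition weakly_decreasing_on (R : realType) (J : set R) (f : R -> R) :=
  {in J &, {homo f : x y /~ x <= y}}.

Definition strictly_decreasing_on (R : realType) (J : set R) (f : R -> R) :=
  {in J &, {homo f : x y /~ x < y}}.

Definition constant_on (R : realType) (J : set R) (f : R -> R) :=
  {in J &, forall x y, f x = f y}.

(* Main.v *)
Require Import Defs.
From HB Require Import structures.
From mathcomp Require Import all_boot all_order all_algebra.
From mathcomp Require Import all_classical all_reals all_analysis.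
From mathcomp Require Import ring lra.

Set Implicit Arguments.
Unset Strict Implicit.
Unset Printing Implicit Defensive.

Import Order.TTheory GRing.Theory Num.Theory.
Import numFieldNormedType.Exports.

Local Open Scope classical_set_scope.
Local Open Scope ring_scope.

(** Write s = A - c - d - Q for the margin left by the total output Q, K for the
    total emission and t_i = b alpha_i^2 for the effective emission tax of
    firm i.  A firm that takes s and K as given emits

      k_i = max(0, min(d / t_i - K, (s + d - t_i K) / (1 + t_i)))

    and produces q_i = max(s, k_i): this is what the first-order conditions of
    its concave problem in the variables (k, q), 0 <= k <= q, amount to
    ([optimal_first_order], [first_order_best_emission]).  So an equilibrium
    without white firms is a pair (s, K) at which both markets clear.  Both k_i
    and q_i increase with s and decrease with K, whereas the slack q_i - k_i
    increases with both; these signs drive everything.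

    The belief of firm l acts on the rest of the economy only through its own
    emission k_l.  Eliminating the other firms gives the two relations

      s + O(s, K) + max(s, k_l) = A - c - d,   K = K_ex + E(s, K) + k_l

    between s, K and k_l ([clears]).  The first one and the difference of the
    two have terms of constant sign.  When k_l falls they yield, whatever the
    colors, that K falls; moreover s strictly rises if firm l is red throughout
    ([clears_red]) and weakly falls if it is green or orange throughout
    ([clears_not_red]).  A higher own belief lowers k_l, strictly as long as
    firm l emits ([own_emission_le], [own_emission_lt]).  The responses of the
    other firms are then read off their formulas.

    Colors are known only in the interior of J.  The same sign arguments bound
    the change of (s, K, k_l) by the change, at fixed (s, K), of the response
    of firm l to its tax ([own_response_le_left], [own_response_le_right]); so
    the equilibrium depends continuously on the belief, and monotonicity passes
    from the interior to the end points.

    For the ambiguous case, with firm i red and the belief of an orange firm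
    varying, the margin s and the emission K both fall and q_i moves with
    s - t_i K.  The ratio of the two changes depends on the other firms: in a
    duopoly the fall of K dominates, and one more red firm with a high belief
    makes the fall of s dominate. *)

(** * The response of a firm to the margin and the total emission *)

Section BestEmission.
Context {R : realType}.
Implicit Types (d t s K : R).

(** With m = d / t - K the unconstrained optimum, the second argument of the
    minimum is a weighted mean of s and m. Hence it is the smaller one exactly
    when s <= m, where the constraint k <= q binds and the firm is red; the
    outer maximum cuts off at green firms. *)
Definition best_emission d t s K : R :=
  Num.max 0 (Num.min (d / t - K) ((s + d - t * K) / (1 + t))).

Lemma best_emission_ge0 d t s K : 0 <= best_emission d t s K.
Proof. by rewrite /best_emission le_max lexx. Qed.

Lemma best_emission_homo d t s K s' K' : 0 < t -> s <= s' -> K' <= K ->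
  best_emission d t s K <= best_emission d t s' K'.
Proof.
move=> t0 ss KK; rewrite /best_emission le_max2 ?le_min2 ?lerB //.
by rewrite ler_pM2r ?invr_gt0; nra.
Qed.

(** Slope at most 1 in s is what makes the slack [max s k - k] nondecreasing in
    the margin, so that the clearing conditions have a unique solution. *)
Lemma best_emission_lipschitz d t s K s' K' : 0 < t -> s <= s' -> K' <= K ->
  best_emission d t s' K' - best_emission d t s K <= (s' - s) + (K - K').
Proof.
move=> t0 ss KK; rewrite /best_emission.
have : (s' + d - t * K') / (1 + t) - (s + d - t * K) / (1 + t)
       <= (s' - s) + (K - K').
  rewrite -mulrBl ler_pdivrMr; last by lra.
  have h : 0 <= t * (s' - s) by rewrite mulr_ge0 ?subr_ge0// ltW.
  by lra.
by case: (leP (d / t - K')) => ?; case: (leP (d / t - K)) => ?;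
  do 2 case: (leP 0) => ?; lra.
Qed.

Lemma best_emission_strict_K d t s K K' : 0 < t -> K' < K ->
  0 < best_emission d t s K -> best_emission d t s K < best_emission d t s K'.
Proof.
move=> t0 KK; rewrite /best_emission.
have : (s + d - t * K) / (1 + t) < (s + d - t * K') / (1 + t).
  by rewrite ltr_pM2r ?invr_gt0; nra.
by case: (leP (d / t - K')) => ?; case: (leP (d / t - K)) => ?;
  do 2 case: (leP 0) => ?; lra.
Qed.

(** On the binding branch the derivative in t has the sign of - (s + d + K),
    which is negative because a positive value forces s + d > t K >= 0. *)
Lemma best_emission_strict_t d t t' s K : 0 < t -> 0 < d -> 0 <= K -> t < t' ->
  0 < best_emission d t' s K -> best_emission d t' s K < best_emission d t s K.
Proof.
move=> t0 d0 K0 tt; rewrite /best_emission.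
have t'0 : 0 < t' by lra.
have dt : d / t' < d / t by rewrite ltr_pM2l// ltf_pV2.
have : 0 < (s + d - t' * K) / (1 + t') ->
    (s + d - t' * K) / (1 + t') < (s + d - t * K) / (1 + t).
  have : s + d - t' * K <= s + d - t * K by rewrite lerB ?ler_wpM2r// ltW.
  move: (s + d - t * K) (s + d - t' * K) => u v vu.
  rewrite pmulr_lgt0 ?invr_gt0; last by lra.
  move=> v0; apply: (@lt_le_trans _ _ (v / (1 + t))).
    by rewrite ltr_pM2l// ltf_pV2 ?posrE; lra.
  by rewrite ler_pM2r ?invr_gt0; lra.
by case: (leP (d / t' - K)) => ?; case: (leP (d / t - K)) => ?;
  do 2 case: (leP 0) => ?; lra.
Qed.

(** An emission below s rules out the branch where k = q. *)
Lemma best_emission_orange d t s K : 0 < t -> 0 < best_emission d t s K <= s ->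
  best_emission d t s K = d / t - K.
Proof.
move=> t0; rewrite /best_emission => /andP[].
have dt : t * (d / t) = d by rewrite mulrC divfK ?gt_eqF.
case: (leP (d / t - K)) => mK; case: (leP 0) => m0 m1 m2; try lra.
move: mK m2; rewrite ltr_pdivrMr ?ler_pdivrMr; try lra.
move: (d / t) dt m0 => m dt m0 mK m2.
have : t * (m - K) <= t * s by lra.
by rewrite ler_pM2l//; lra.
Qed.

Lemma best_emission_continuous d s K t : 0 < t ->
  {for t, continuous (fun t => best_emission d t s K)}.
Proof.
move=> t0; apply: continuous_max; first exact: cvg_cst.
apply: continuous_min.
  apply: cvgB; last exact: cvg_cst.
  by apply: cvgMr; apply: cvgV; [rewrite gt_eqF | exact: cvg_id].
apply: cvgM; last first.
  apply: cvgV; first by rewrite gt_eqF//; lra.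
  by apply: cvgD; [exact: cvg_cst | exact: cvg_id].
by apply: cvgB; [exact: cvg_cst | apply: cvgMl; exact: cvg_id].
Qed.
End BestEmission.

Lemma best_emission_dist (R : realType) (d t s K s' K' : R) : 0 < t ->
  `|best_emission d t s' K' - best_emission d t s K| <= `|s' - s| + `|K' - K|.
Proof.
move=> t0.
suff lip (a b a' b' : R) : best_emission d t a' b' - best_emission d t a b
    <= `|a' - a| + `|b' - b|.
  by rewrite ler_norml lip andbT -lerN2 opprK opprB (distrC s') (distrC K') lip.
have h1 : a <= Num.max a a' by rewrite le_max lexx.
have h1' : a' <= Num.max a a' by rewrite le_max lexx orbT.
have h2 : Num.min b b' <= b by rewrite ge_min lexx.
have h2' : Num.min b b' <= b' by rewrite ge_min lexx orbT.
have := best_emission_homo d t0 h1' h2'.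
have := best_emission_lipschitz d t0 h1 h2.
have : Num.max a a' - a <= `|a' - a|.
  by case: (leP a a') => ?; [exact: ler_norm | rewrite subrr normr_ge0].
have : b - Num.min b b' <= `|b' - b|.
  by case: (leP b b') => ?; [rewrite subrr normr_ge0 | rewrite distrC ler_norm].
lra.
Qed.

Lemma max_dist (R : realType) (s k s' k' : R) :
  `|Num.max s' k' - Num.max s k| <= `|s' - s| + `|k' - k|.
Proof.
have h1 := ler_norm (s' - s); have h2 := ler_norm (k' - k).
have h3 := ler_norm (s - s'); have h4 := ler_norm (k - k').
have n1 := normr_ge0 (s' - s); have n2 := normr_ge0 (k' - k).
rewrite (distrC s) in h3; rewrite (distrC k) in h4.
rewrite ler_norml.
by case: (leP s k) => ?; case: (leP s' k') => ?; apply/andP; split; lra.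
Qed.

(** * First-order conditions and best replies *)

Section FirstOrder.
Context {R : realType}.
Implicit Types (t d s K k q : R).

(** Karush-Kuhn-Tucker conditions for the cone 0 <= k <= q: the gradient of the
    profit at (q, k) is (s - q, d - t (K + k)); it is nonpositive on the extreme
    rays (1, 0) and (1, 1) and orthogonal to (q, k). *)
Definition first_order_conditions (t d s K k q : R) : Prop :=
  [/\ s <= q, d - t * (K + k) <= q - s
    & (q - s) * q = (d - t * (K + k)) * k].

(** The three cases k = 0, 0 < k < q and k = q are the colors green, orange and
    red; in the middle one complementarity forces both multipliers to vanish. *)
Lemma first_order_best_emission t d s K k q :
  0 < t -> 0 < q -> 0 <= k <= q -> first_order_conditions t d s K k q ->
  k = best_emission d t s K /\ q = Num.max s k.
Proof.
move=> t0 q0 /andP[+ kq] [sq tm comp].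
have dt : d = t * (d / t) by rewrite mulrC divfK ?gt_eqF.
have t1 : 0 < 1 + t by lra.
have rhoE u : s + d - t * K = u -> (s + d - t * K) / (1 + t) = u / (1 + t).
  by move->.
rewrite /best_emission; move: (d / t) dt rhoE => m dt rhoE.
rewrite le_eqVlt => /orP[/eqP kE|k0].
  move: comp; rewrite -kE mulr0 => /eqP; rewrite mulf_eq0 (gt_eqF q0) orbF.
  rewrite subr_eq0 => /eqP qs; rewrite -qs (max_l (ltW q0)); split => //.
  have mK : m - K <= 0.
    by rewrite -(pmulr_rle0 _ t0); move: tm; rewrite -kE dt; lra.
  by rewrite max_l// ge_min mK.
move: sq; rewrite le_eqVlt => /orP[/eqP qs|qs].
  have /eqP : (d - t * (K + k)) * k = 0 by rewrite -comp qs subrr mul0r.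
  rewrite mulf_eq0 (gt_eqF k0) orbF => /eqP tax0.
  have mK : m - K = k.
    by apply: (mulfI (lt0r_neq0 t0)); move: tax0; rewrite {1}dt; lra.
  rewrite mK min_l; last by rewrite ler_pdivlMr//; lra.
  by rewrite max_r ?max_l ?(ltW k0)// qs.
have kqE : k = q.
  apply/eqP; rewrite eq_le kq/= leNgt; apply/negP => kq'.
  have : 0 < (q - s) * (q - k) by rewrite mulr_gt0// subr_gt0.
  have : (d - t * (K + k)) * k <= (q - s) * k by rewrite ler_pM2r.
  lra.
have taxE : d - t * (K + k) = q - s.
  by apply: (mulIf (lt0r_neq0 q0)); rewrite comp kqE.
have -> : (s + d - t * K) / (1 + t) = k.
  by rewrite (rhoE (k * (1 + t))) ?mulfK ?gt_eqF//; lra.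
rewrite min_r; first by rewrite !max_r ?(ltW k0)// kqE ltW.
by rewrite -(ler_pM2l t0) mulrBr -dt; lra.
Qed.

End FirstOrder.

Section BestReply.
Context {R : realType}.
Variables (M : market R) (a Qm Km r q t s K k : R).
Hypotheses (a_gt0 : 0 < a) (Km_ge0 : 0 <= Km).
Hypotheses (r01 : 0 <= r <= 1) (q_gt0 : 0 < q).
Hypotheses (tE : t = mkb M * a) (kE : k = r * q).
Hypotheses (sE : s = mkA M - mkc M - mkd M - (q + Qm)) (KE : K = Km + k).

Let t_gt0 : 0 < t. Proof. by rewrite tE mulr_gt0// mkb_gt0. Qed.
Let k_ge0 : 0 <= k.
Proof. by case/andP: r01 => r0 _; rewrite kE mulr_ge0// ltW. Qed.
Let k_le : k <= q.
Proof. by case/andP: r01 => _ r1; rewrite kE ler_piMl// ltW. Qed.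

(** Extracts the first-order term X from an expansion along a segment. *)
Lemma vanishing_slope (X Y : R) : 0 <= Y ->
  (forall e, 0 < e <= 2^-1 -> X <= e * Y) -> X <= 0.
Proof.
move=> Y0 h; rewrite leNgt; apply/negP => X0.
have XY : 0 < 2 * (X + Y) by lra.
have /h : 0 < X / (2 * (X + Y)) <= 2^-1.
  by rewrite divr_gt0//= ler_pdivrMr//; lra.
rewrite mulrAC ler_pdivlMr// ler_pM2l//; lra.
Qed.

(** In the variables (q, k) with k = r q the choice set is a convex cone and the
    profit dominates a concave quadratic function, with equality at the optimum
    because the price is nonnegative there. So the optimum also maximizes the
    quadratic function over the cone. *)
Lemma optimal_first_order :
  (forall r' q', 0 <= r' <= 1 -> 0 <= q' ->
     profit M a Qm Km r' q' <= profit M a Qm Km r q) ->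
  first_order_conditions t (mkd M) s K k q.
Proof.
move=> opt; have c0 := mkc_gt0 M; have d0 := mkd_gt0 M.
have price : 0 <= mkA M - q - Qm.
  rewrite leNgt; apply/negP => p0.
  have := opt 0 0; rewrite lexx ler01 => /(_ isT isT).
  rewrite /profit (max_r (ltW p0)) -kE -tE.
  have : 0 <= t * (k + Km) * k.
    by rewrite mulr_ge0// mulr_ge0 ?addr_ge0// ltW.
  have : mkd M * r * q <= mkd M * q by rewrite -mulrA -kE ler_pM2l.
  have : 0 < mkc M * q by rewrite mulr_gt0.
  lra.
have vi q' k' : 0 <= k' -> k' <= q' ->
    (s - q) * (q' - q) + (mkd M - t * (K + k)) * (k' - k) <= 0.
  move=> k'0 kq'.
  apply: (@vanishing_slope _ ((q' - q) ^+ 2 + t * (k' - k) ^+ 2)).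
    by rewrite addr_ge0 ?sqr_ge0// mulr_ge0 ?sqr_ge0// ltW.
  move=> e /andP[e0 e1].
  (* The end points of the segment lie in the cone and e < 1, so the output qe is
     positive and the pair corresponds to the technology ke / qe. *)
  pose qe := q + e * (q' - q); pose ke := k + e * (k' - k).
  have qe0 : 0 < qe.
    have -> : qe = (1 - e) * q + e * q' by rewrite /qe; ring.
    have : 0 < (1 - e) * q by rewrite mulr_gt0//; lra.
    have : 0 <= e * q' by rewrite mulr_ge0//; lra.
    by lra.
  have ke0 : 0 <= ke.
    have -> : ke = (1 - e) * k + e * k' by rewrite /ke; ring.
    have : 0 <= (1 - e) * k by rewrite mulr_ge0//; lra.
    have : 0 <= e * k' by rewrite mulr_ge0//; lra.
    by lra.
  have keqe : ke <= qe.
    have : 0 <= (1 - e) * (q - k) by rewrite mulr_ge0 ?subr_ge0//; lra.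
    have : 0 <= e * (q' - k') by rewrite mulr_ge0 ?subr_ge0// ltW.
    by rewrite /ke /qe; lra.
  have := opt (ke / qe) qe; rewrite (ltW qe0) divr_ge0 ?(ltW qe0)//=.
  rewrite ler_pdivrMr ?mul1r// keqe => /(_ isT isT).
  rewrite /profit -mulrA (mulrBl qe) -[mkd M * (ke / qe) * qe]mulrA.
  rewrite divfK ?gt_eqF// (max_l price) -kE -tE.
  have : (mkA M - qe - Qm) * qe <= Num.max (mkA M - qe - Qm) 0 * qe.
    by rewrite ler_pM2r// le_max lexx.
  move=> h1 h2.
  rewrite -(ler_pM2l e0) -subr_ge0.
  rewrite sE KE.
  have {h1 h2} := le_trans (lerB (lerB h1 (lexx _)) (lexx _)) h2.
  rewrite /qe /ke -subr_ge0 => h.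
  apply: le_trans h _; rewrite le_eqVlt; apply/orP; left; apply/eqP.
  by rewrite kE; ring.
have k2 : 2 * k <= 2 * q by rewrite ler_pM2l.
have k1 : k + 1 <= q + 1 by rewrite lerD2r.
have := vi 0 0 (lexx _) (lexx _).
have := vi _ _ (mulr_ge0 (ler0n _ 2) k_ge0) k2.
have := vi (q + 1) k k_ge0 (ler_wpDr ler01 k_le).
have := vi _ _ (addr_ge0 k_ge0 ler01) k1.
rewrite /first_order_conditions; move: (mkd M - t * (K + k)) => tax.
by split; lra.
Qed.

(** At a nonnegative price the profit is the concave quadratic function, for
    which the first-order conditions suffice; at a zero price it is at most 0,
    the profit of not producing. *)
Lemma first_order_optimal : first_order_conditions t (mkd M) s K k q ->
  forall r' q', 0 <= r' <= 1 -> 0 <= q' ->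
    profit M a Qm Km r' q' <= profit M a Qm Km r q.
Proof.
move=> [sq tm comp] r' q' /andP[r'0 r'1] q'0.
have c0 := mkc_gt0 M; have d0 := mkd_gt0 M.
have k'0 : 0 <= r' * q' by rewrite mulr_ge0.
have smooth r1 q1 : 0 <= r1 <= 1 -> 0 <= q1 ->
    (mkA M - q1 - Qm) * q1 - mkb M * a * (r1 * q1 + Km) * (r1 * q1)
      - (mkc M + mkd M - mkd M * r1) * q1 <= profit M a Qm Km r q.
  move=> /andP[r10 r11] q10.
  have k10 : 0 <= r1 * q1 by rewrite mulr_ge0.
  have k1q : r1 * q1 <= q1 by rewrite ler_piMl.
  apply: (@le_trans _ _ ((mkA M - q - Qm) * q
      - mkb M * a * (r * q + Km) * (r * q)
      - (mkc M + mkd M - mkd M * r) * q)); last first.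
    by rewrite /profit !lerB// ler_pM2r// le_max lexx.
  have vi : (s - q) * (q1 - q) + (mkd M - t * (K + k)) * (r1 * q1 - k) <= 0.
    have : (mkd M - t * (K + k)) * (r1 * q1) <= (q - s) * q1.
      have [l0|l0] := ltP 0 (mkd M - t * (K + k)).
        by rewrite ler_pM// ltW.
      by rewrite (@le_trans _ _ 0) ?mulr_le0_ge0// mulr_ge0// subr_ge0.
    by move: comp; lra.
  have sq1 : 0 <= (q1 - q) ^+ 2 by exact: sqr_ge0.
  have sq2 : 0 <= t * (r1 * q1 - k) ^+ 2 by rewrite mulr_ge0 ?sqr_ge0// ltW.
  rewrite -subr_ge0; apply: le_trans (_ : - ((s - q) * (q1 - q)
    + (mkd M - t * (K + k)) * (r1 * q1 - k))
    + (q1 - q) ^+ 2 + t * (r1 * q1 - k) ^+ 2 <= _).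
    lra.
  rewrite le_eqVlt; apply/orP; left; apply/eqP.
  by rewrite sE KE kE tE; ring.
have [p0|p0] := leP 0 (mkA M - q' - Qm).
  by rewrite {1}/profit max_l// smooth// r'0.
apply: (@le_trans _ _ 0).
  rewrite /profit (max_r (ltW p0)) mul0r -tE.
  have : 0 <= t * (r' * q' + Km) * (r' * q').
    by rewrite mulr_ge0// mulr_ge0 ?addr_ge0// ltW.
  have : mkd M * r' * q' <= mkd M * q'.
    by rewrite -mulrA ler_pM2l// ler_piMl.
  have : 0 <= mkc M * q' by rewrite mulr_ge0// ltW.
  lra.
(* Compare with not producing at all. *)
have := smooth 0 0; rewrite lexx ler01 => /(_ isT isT).
by rewrite !mulr0 !subr0.
Qed.

End BestReply.

(** * Equilibria in terms of margin and total emission *)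

Section EquilibriumAggregates.
Context {R : realType}.
Variables (M : market R) (n : nat).
Implicit Types (alpha r q : 'I_n -> R).

Definition margin q : R := mkA M - mkc M - mkd M - \sum_(j < n) q j.

Definition total_emission r q : R := mkKex M + \sum_(j < n) r j * q j.

Lemma others_quantityE q i : q i + others_quantity q i = \sum_(j < n) q j.
Proof. by rewrite /others_quantity [RHS](bigD1 i). Qed.

Lemma others_emissionE r q i :
  total_emission r q = others_emission M r q i + r i * q i.
Proof.
rewrite /total_emission /others_emission (bigD1 i)//= -addrA.
by rewrite (addrC (r i * q i)).
Qed.

(** Gives the aggregate form of the equilibrium: every firm responds to the same
    pair of margin and total emission. *)
Lemma equilibrium_best_emission alpha r q : (forall m, 0 < alpha m) ->
  equilibrium M alpha r q -> (forall m, q m <> 0) -> forall i,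
  r i * q i = best_emission (mkd M) (mkb M * alpha i)
                (margin q) (total_emission r q) /\
  q i = Num.max (margin q) (r i * q i).
Proof.
move=> a0 eq q0 i; have [r01 qi0 _ opt] := eq i.
have qi : 0 < q i by rewrite lt_neqAle qi0 andbT eq_sym; apply/eqP/q0.
have Km : 0 <= others_emission M r q i.
  rewrite /others_emission addr_ge0 ?mkKex_ge0//; apply: sumr_ge0 => j _.
  by have [/andP[rj _] qj _ _] := eq j; rewrite mulr_ge0.
have sE : margin q
    = mkA M - mkc M - mkd M - (q i + others_quantity q i).
  by rewrite others_quantityE.
have foc := optimal_first_order (a0 i) Km r01 qi erefl erefl sE
  (others_emissionE r q i) opt.
apply: first_order_best_emission foc => //.
  by rewrite mulr_gt0// mkb_gt0.
by case/andP: r01 => r0 r1; rewrite mulr_ge0//= ler_piMl.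
Qed.

Lemma first_order_equilibrium alpha r q : (forall m, 0 < alpha m) ->
  (forall m, 0 <= r m <= 1) -> (forall m, 0 < q m) ->
  (forall m, first_order_conditions (mkb M * alpha m) (mkd M) (margin q)
               (total_emission r q) (r m * q m) (q m)) ->
  equilibrium M alpha r q.
Proof.
move=> a0 r01 q0 foc i; split=> //; first exact: ltW.
  by move=> qi; have := q0 i; rewrite qi ltxx.
have Km : 0 <= others_emission M r q i.
  rewrite /others_emission addr_ge0 ?mkKex_ge0//; apply: sumr_ge0 => j _.
  by have /andP[rj _] := r01 j; rewrite mulr_ge0// ltW.
have sE : margin q = mkA M - mkc M - mkd M - (q i + others_quantity q i).
  by rewrite others_quantityE.
exact: (first_order_optimal (a0 i) Km (q0 i) erefl erefl sE
  (others_emissionE r q i) (foc i)).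
Qed.

End EquilibriumAggregates.

(** * The economy as seen from one firm *)

Section ResidualEconomy.
Context {R : realType} {n : nat}.
Variables (t : 'I_n -> R) (d N Kx : R) (l : 'I_n).
Hypothesis t_gt0 : forall m, m != l -> 0 < t m.
Implicit Types (s K k : R).

Definition rivals_output s K : R :=
  \sum_(m < n | m != l) Num.max s (best_emission d (t m) s K).

Definition rivals_emission s K : R :=
  \sum_(m < n | m != l) best_emission d (t m) s K.

(** The supply of clean output of the other firms. Unlike their output and their
    emission it moves in the same direction with s and with K. *)
Definition rivals_slack s K : R := rivals_output s K - rivals_emission s K.

(** Market clearing when firm [l] emits k and produces [max s k]. Its belief
    does not occur, so it affects the rest of the economy only through k. *)
Definition clears s K k : Prop :=
  s + rivals_output s K + Num.max s k = N /\ K = Kx + rivals_emission s K + k.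

Lemma rivals_output_homo s K s' K' : s <= s' -> K' <= K ->
  rivals_output s K <= rivals_output s' K'.
Proof.
move=> ss KK; apply: ler_sum => m ml.
by rewrite le_max2// best_emission_homo// t_gt0.
Qed.

Lemma rivals_emission_homo s K s' K' : s <= s' -> K' <= K ->
  rivals_emission s K <= rivals_emission s' K'.
Proof.
by move=> ss KK; apply: ler_sum => m ml; rewrite best_emission_homo// t_gt0.
Qed.

Lemma rivals_slack_homo s K s' K' : s <= s' -> K <= K' ->
  rivals_slack s K <= rivals_slack s' K'.
Proof.
move=> ss KK; rewrite /rivals_slack -!sumrB; apply: ler_sum => m ml.
have := best_emission_lipschitz d (t_gt0 ml) ss (lexx K).
have := best_emission_homo d (t_gt0 ml) (lexx s') KK.
by case: (leP s) => ?; case: (leP s') => ?; lra.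
Qed.

Lemma rivals_slack_lipschitz s K s' K' : s <= s' -> K' <= K ->
  rivals_slack s' K' - rivals_slack s K <= n%:R * (s' - s).
Proof.
move=> ss KK; rewrite /rivals_slack -!sumrB.
apply: (@le_trans _ _ (\sum_(m < n | m != l) (s' - s))).
  apply: ler_sum => m ml.
  have := best_emission_homo d (t_gt0 ml) ss KK.
  by case: (leP s) => ?; case: (leP s') => ?; lra.
rewrite sumr_const -[leLHS]mulr_natl ler_wpM2r ?subr_ge0// ler_nat.
by rewrite -[leqRHS](card_ord n) max_card.
Qed.

(** Subtracting the two clearing conditions; every term on the left is
    nondecreasing in s and in K. *)
Lemma clears_slack s K k : clears s K k ->
  s + K + rivals_slack s K + (Num.max s k - k) = N + Kx.
Proof. by rewrite /clears /rivals_slack => -[h1 h2]; lra. Qed.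

Section Comparison.
Variables (s K k s' K' k' : R).
Hypotheses (sKk : clears s K k) (sKk' : clears s' K' k').

(** If K rose, a higher s would violate [clears_slack], and a lower s would
    lower every output in the first clearing condition. *)
Lemma clears_emission_le : k' <= k -> K' <= K.
Proof.
move=> kk; rewrite leNgt; apply/negP => KK.
have [h1 _] := sKk; have [h1' _] := sKk'.
have g := clears_slack sKk; have g' := clears_slack sKk'.
have [ss|ss] := leP s s'.
  have := rivals_slack_homo ss (ltW KK).
  by move: g g'; case: (leP s k) => ? g; case: (leP s' k') => ? g'; lra.
have := rivals_output_homo (ltW ss) (ltW KK).
by move: h1 h1'; case: (leP s k) => ?; case: (leP s' k') => ?; lra.
Qed.

(** In [clears_slack] a fall of s counts once by itself and once more in the
    slack of firm [l], which can offset at most the change of k. The factor 2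
    turns the own response below into a contraction. *)
Lemma clears_margin_half : k' <= k -> 2%:R * (s - s') <= k - k'.
Proof.
move=> kk; have KK := clears_emission_le kk.
have [ss|ss] := leP s s'; first by lra.
have := rivals_slack_homo (ltW ss) KK.
have := clears_slack sKk; have := clears_slack sKk'.
by case: (leP s k) => ?; case: (leP s' k') => ?; lra.
Qed.

Lemma clears_lipschitz : k' <= k ->
  `|s - s'| <= k - k' /\ K - K' <= (n%:R + 3%:R) * (k - k').
Proof.
move=> kk; have KK := clears_emission_le kk.
have half := clears_margin_half kk.
have n0 : 0 <= n%:R :> R by [].
have nk : 0 <= n%:R * (k - k') by rewrite mulr_ge0//; lra.
have g := clears_slack sKk; have g' := clears_slack sKk'.
have [ss|ss] := leP s s'; last first.
  rewrite gtr0_norm ?subr_gt0//; have := rivals_slack_homo (ltW ss) KK.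
  by move: g g'; case: (leP s k) => ?; case: (leP s' k') => ? g g'; split; lra.
(* K falls by the rise of s, by at most n times this rise through the slack of
   the other firms and by at most 2 (k - k') through the slack of firm l. *)
have s's : s' - s <= k - k'.
  have [h1 _] := sKk; have [h1' _] := sKk'; have := rivals_output_homo ss KK.
  by move: h1 h1'; case: (leP s k) => ?; case: (leP s' k') => ?; lra.
rewrite ler0_norm ?subr_le0//; split; first by lra.
have := rivals_slack_lipschitz ss KK.
have : n%:R * (s' - s) <= n%:R * (k - k') by rewrite ler_wpM2l.
by move: g g'; case: (leP s k) => ? g; case: (leP s' k') => ? g'; lra.
Qed.

Lemma clears_unique : k = k' -> s = s' /\ K = K'.
Proof.
move=> kk; have [] := clears_lipschitz; first by rewrite kk.
rewrite kk subrr mulr0 normr_le0 subr_eq0 => /eqP -> KK; split => //.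
apply/eqP; rewrite eq_le clears_emission_le ?kk//; lra.
Qed.

(** A red firm has no slack, so [clears_slack] does not see k, and s has to make
    up for the lower K. *)
Lemma clears_red : s <= k -> s' <= k' -> k' < k -> s < s' /\ K' < K.
Proof.
move=> sk sk' kk; have KK := clears_emission_le (ltW kk).
have := clears_slack sKk; have := clears_slack sKk'.
rewrite !max_r// !subrr !addr0 => g' g.
have [_ h] := sKk; have [_ h'] := sKk'.
have ss : s < s'.
  rewrite ltNge; apply/negP => ss; have sl := rivals_slack_homo ss KK.
  have sE : s' = s by lra.
  have KE : K' = K by lra.
  by move: h'; rewrite sE KE; lra.
split=> //; rewrite lt_neqAle KK andbT; apply/eqP => KE.
by have := rivals_slack_homo (ltW ss) (lexx K); move: g'; rewrite KE; lra.
Qed.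

(** A firm that is not red produces s whatever its emission, so the first
    clearing condition does not see k, and s has to make up for the higher
    output that the lower K induces. *)
Lemma clears_not_red : k <= s -> k' <= s' -> k' < k ->
  [/\ s' <= s, K' < K & s' = s -> rivals_output s K' = rivals_output s K].
Proof.
move=> ks ks' kk; have KK := clears_emission_le (ltW kk).
have [h1 h2] := sKk; have [h1' h2'] := sKk'.
move: h1 h1'; rewrite !max_l// => h1 h1'.
have ss : s' <= s.
  rewrite leNgt; apply/negP => ss; have := rivals_output_homo (ltW ss) KK.
  by lra.
split=> // [|sE]; last by move: h1'; rewrite sE; lra.
rewrite lt_neqAle KK andbT; apply/eqP => KE.
by have := rivals_emission_homo ss (lexx K); move: h2'; rewrite KE; lra.
Qed.

End Comparison.

(** Only red firms let their output depend on K; one of them makes the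
    dependence of the total strict. *)
Lemma rivals_output_lt s K K' m : m != l -> K' < K ->
  s <= best_emission d (t m) s K -> 0 < best_emission d (t m) s K ->
  rivals_output s K < rivals_output s K'.
Proof.
move=> ml KK sb b0; rewrite /rivals_output !(bigD1 m ml)/=.
rewrite ltr_leD//; last first.
  apply: ler_sum => m' /andP[m'l _].
  by rewrite le_max2// best_emission_homo// ?t_gt0// ltW.
have := best_emission_strict_K (t_gt0 ml) KK b0.
by rewrite max_r// => h; rewrite lt_max h orbT.
Qed.

End ResidualEconomy.

Section OwnBelief.
Context {R : realType} {n : nat}.
Variables (t : 'I_n -> R) (d N Kx : R) (l : 'I_n).
Hypotheses (d_gt0 : 0 < d) (t_gt0 : forall m, m != l -> 0 < t m).
Variables (x s K k x' s' K' k' : R).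
Hypotheses (x_gt0 : 0 < x) (x'_gt0 : 0 < x').
Hypotheses (sKk : clears t d N Kx l s K k) (sKk' : clears t d N Kx l s' K' k').
Hypothesis kE : k = best_emission d x s K.
Hypothesis k'E : k' = best_emission d x' s' K'.

(** The feedback through K works in favor of the bound and the feedback through
    s is at most half of the change of k, by [clears_margin_half]. What remains
    is twice the direct effect of the tax, here taken at the first state. *)
Lemma own_response_le_left : k' <= k ->
  k - k' <= 2%:R * (best_emission d x s K - best_emission d x' s K).
Proof.
move=> kk; have KK := clears_emission_le t_gt0 sKk sKk' kk.
have half := clears_margin_half t_gt0 sKk sKk' kk.
have hK := best_emission_homo d x'_gt0 (lexx s') KK.
rewrite -kE; move: hK; rewrite -k'E => hK.
have [ss|ss] := leP s s'.
  have := best_emission_homo d x'_gt0 ss (lexx K).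
  move: (best_emission d x' s K) (best_emission d x' s' K) hK => u v.
  by clear kE k'E half; lra.
have := best_emission_lipschitz d x'_gt0 (ltW ss) (lexx K).
move: (best_emission d x' s K) (best_emission d x' s' K) hK => u v.
by clear kE k'E; lra.
Qed.

(** The same bound with the direct effect at the second state, as needed at a
    right end point. *)
Lemma own_response_le_right : k' <= k ->
  k - k' <= 2%:R * (best_emission d x s' K' - best_emission d x' s' K').
Proof.
move=> kk; have KK := clears_emission_le t_gt0 sKk sKk' kk.
have half := clears_margin_half t_gt0 sKk sKk' kk.
have hK := best_emission_homo d x_gt0 (lexx s) KK.
rewrite -k'E; move: hK; rewrite -kE => hK.
have [ss|ss] := leP s s'.
  have := best_emission_homo d x_gt0 ss (lexx K').
  move: (best_emission d x s K') (best_emission d x s' K') hK => u v.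
  by clear kE k'E half; lra.
have := best_emission_lipschitz d x_gt0 (ltW ss) (lexx K').
move: (best_emission d x s K') (best_emission d x s' K') hK => u v.
by clear kE k'E; lra.
Qed.

(** A higher emission would come with a higher K and a margin that rises by less
    than the emission does; a firm with a higher tax does not respond to that by
    emitting so much more. *)
Lemma own_emission_le : 0 <= K -> x < x' -> k' <= k.
Proof.
move=> K0 xx; rewrite leNgt; apply/negP => kk.
have KK := clears_emission_le t_gt0 sKk' sKk (ltW kk).
have half := clears_margin_half t_gt0 sKk' sKk (ltW kk).
have hK := best_emission_homo d x'_gt0 (lexx s') KK.
have ht : best_emission d x' s K <= best_emission d x s K.
  have [b0|] := ltP 0 (best_emission d x' s K).
    exact/ltW/best_emission_strict_t.
  by move/le_trans; apply; exact: best_emission_ge0.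
have [ss|ss] := leP s s'.
  have := best_emission_lipschitz d x'_gt0 ss (lexx K).
  move: hK ht; rewrite -k'E -kE.
  move: (best_emission d x' s K) (best_emission d x' s' K) => u v.
  by clear kE k'E; lra.
have := best_emission_homo d x'_gt0 (ltW ss) (lexx K).
move: hK ht; rewrite -k'E -kE.
move: (best_emission d x' s K) (best_emission d x' s' K) => u v.
by clear kE k'E half; lra.
Qed.

(** Equal emissions would mean the same (s, K), hence a different response. *)
Lemma own_emission_lt : 0 <= K -> x < x' -> 0 < k -> k' < k.
Proof.
move=> K0 xx k0; rewrite lt_neqAle own_emission_le// andbT.
apply/eqP => kk; have [sE KE] := clears_unique t_gt0 sKk' sKk kk.
have : best_emission d x' s K = k by rewrite -kk k'E sE KE.
move=> bk; have := best_emission_strict_t (s := s) x_gt0 d_gt0 K0 xx.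
by rewrite bk -kE ltxx => /(_ k0).
Qed.

(** A higher output with a lower emission would need a higher margin, and then
    all other outputs would rise as well. *)
Lemma own_output_le : k' <= k -> Num.max s' k' <= Num.max s k.
Proof.
move=> kk; have KK := clears_emission_le t_gt0 sKk sKk' kk.
have [h1 _] := sKk; have [h1' _] := sKk'; rewrite leNgt; apply/negP => mm.
have ss : s <= s'.
  by move: mm; case: (leP s k) => ?; case: (leP s' k') => ? ?; lra.
by have := rivals_output_homo d t_gt0 ss KK; lra.
Qed.
End OwnBelief.

(** * Monotonicity from the interior of an interval *)

Section FromInterior.
Context {R : realType}.
Variables (J : set R) (f : R -> R).
Hypothesis Jitv : is_interval J.
Hypothesis f_cont : forall x, J x -> f u @[u --> within J (nbhs x)] --> f x.

Lemma between_interior x y u : J x -> J y -> x < u < y -> J° u.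
Proof.
move=> Jx Jy xuy; suff : `]x, y[ `<=` J° by apply; rewrite /= in_itv.
rewrite -open_subsetE; last exact: itv_open.
move=> v /=; rewrite in_itv/= => /andP[xv vy].
by apply: (Jitv Jx Jy); rewrite (ltW xv) (ltW vy).
Qed.

Lemma le_from_interior :
  (forall u v, J° u -> J° v -> u < v -> f u <= f v) ->
  forall x y, J x -> J y -> x < y -> f x <= f y.
Proof.
move=> fle x y Jx Jy xy; have Jin := between_interior Jx Jy.
have xw w : x < w < y -> f x <= f w.
  move=> /andP[xw wy].
  apply: (@cvgr_to_le _ x^'+ _ _ f).
    apply: cvg_trans (f_cont Jx); apply: cvg_app => P Px.
    have {}Px : \forall u \near x^'+, J u -> P u by apply: cvg_within.
    near=> u; have Ju : J u.
      by apply: interior_subset; apply: Jin; apply/andP; split; near: u;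
        [exact: nbhs_right_gt | exact: nbhs_right_lt].
    have PJ : J u -> P u by near: u; exact: Px.
    exact: PJ.
  near=> u; have xu : x < u by near: u; exact: nbhs_right_gt.
  have uw : u < w by near: u; exact: nbhs_right_lt.
  by apply: fle => //; apply: Jin; [rewrite xu (lt_trans uw) | rewrite xw].
have wy w : x < w < y -> f w <= f y.
  move=> /andP[xw' wy].
  apply: (@cvgr_to_ge _ y^'- _ _ f).
    apply: cvg_trans (f_cont Jy); apply: cvg_app => P Py.
    have {}Py : \forall u \near y^'-, J u -> P u by apply: cvg_within.
    near=> u; have Ju : J u.
      by apply: interior_subset; apply: Jin; apply/andP; split; near: u;
        [exact: nbhs_left_gt | exact: nbhs_left_lt].
    have PJ : J u -> P u by near: u; exact: Py.
    exact: PJ.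
  near=> u; have uy : u < y by near: u; exact: nbhs_left_lt.
  have wu : w < u by near: u; exact: nbhs_left_gt.
  by apply: fle => //; apply: Jin; [rewrite xw' | rewrite uy (lt_trans xw')].
have [x2 y2] : x < (x + y) / 2 /\ (x + y) / 2 < y by split; lra.
by apply: (le_trans (xw ((x + y) / 2) _) (wy _ _)); rewrite x2 y2.
Unshelve. all: by end_near.
Qed.

(** Stated for continuity relative to J, which is one-sided at an end point. *)
Lemma weakly_increasing_from_interior :
  (forall u v, J° u -> J° v -> u < v -> f u <= f v) ->
  weakly_increasing_on J f.
Proof.
move=> fle x y /set_mem Jx /set_mem Jy; rewrite le_eqVlt => /predU1P[->//|].
exact: le_from_interior.
Qed.

Lemma strictly_increasing_from_interior :
  (forall u v, J° u -> J° v -> u < v -> f u < f v) ->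
  strictly_increasing_on J f.
Proof.
move=> flt x y /set_mem Jx /set_mem Jy xy.
have Jin := between_interior Jx Jy.
(* Two interior points between x and y carry the strict inequality. *)
pose u := (x + y) / 2; pose v := (u + y) / 2.
have xu : x < u by rewrite /u; lra.
have uv : u < v by rewrite /v /u; lra.
have vy : v < y by rewrite /v /u; lra.
have Ju : J° u by apply: Jin; rewrite xu (lt_trans uv).
have Jv : J° v by apply: Jin; rewrite vy (lt_trans xu).
have fle := le_from_interior (fun u v Ju Jv uv => ltW (flt u v Ju Jv uv)).
have fxu := fle _ _ Jx (interior_subset Ju) xu.
have fvy := fle _ _ (interior_subset Jv) Jy vy.
exact: le_lt_trans fxu (lt_le_trans (flt _ _ Ju Jv uv) fvy).
Qed.

End FromInterior.

Section DecreasingFromInterior.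
Context {R : realType}.
Variables (J : set R) (f : R -> R).
Hypothesis Jitv : is_interval J.
Hypothesis f_cont : forall x, J x -> f u @[u --> within J (nbhs x)] --> f x.

Let fN_cont x : J x -> - f u @[u --> within J (nbhs x)] --> - f x.
Proof. by move=> /f_cont; exact: cvgN. Qed.

Lemma weakly_decreasing_from_interior :
  (forall u v, J° u -> J° v -> u < v -> f v <= f u) ->
  weakly_decreasing_on J f.
Proof.
move=> fle x y xJ yJ yx; rewrite -lerN2.
apply: (weakly_increasing_from_interior Jitv fN_cont) => // u v Ju Jv uv.
by rewrite lerN2 fle.
Qed.

Lemma strictly_decreasing_from_interior :
  (forall u v, J° u -> J° v -> u < v -> f v < f u) ->
  strictly_decreasing_on J f.
Proof.
move=> flt x y xJ yJ yx; rewrite -ltrN2.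
apply: (strictly_increasing_from_interior Jitv fN_cont) => // u v Ju Jv uv.
by rewrite ltrN2 flt.
Qed.

Let le_of_eq (a b : R) : a = b -> a <= b.
Proof. by move->. Qed.

Lemma constant_from_interior :
  (forall u v, J° u -> J° v -> u < v -> f u = f v) -> constant_on J f.
Proof.
move=> fE.
have dec := weakly_decreasing_from_interior
  (fun u v Ju Jv uv => le_of_eq (esym (fE u v Ju Jv uv))).
have inc := weakly_increasing_from_interior Jitv f_cont
  (fun u v Ju Jv uv => le_of_eq (fE u v Ju Jv uv)).
move=> x y xJ yJ; apply/eqP; rewrite eq_le.
case: (leP x y) => [xy|/ltW yx]; apply/andP; split.
- exact: inc xJ yJ xy.
- exact: dec yJ xJ xy.
- exact: dec xJ yJ yx.
- exact: inc yJ xJ yx.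
Qed.

End DecreasingFromInterior.

(** * Comparative statics along a regime-preserving interval *)

Section Regime.
Context {R : realType}.
Variables (M : market R) (n : nat) (alpha : 'I_n -> R) (l : 'I_n).
Variables (J : set R) (r q : R -> 'I_n -> R) (col : 'I_n -> color).
Hypothesis reg : regime_preserving M alpha l J r q col.

Let t m := mkb M * alpha m.
Let s x := margin M (q x).
Let K x := total_emission M (r x) (q x).
Let k m := emission r q m.

Let t_gt0 m : m != l -> 0 < t m.
Proof. by move=> _; rewrite mulr_gt0 ?mkb_gt0// (rp_belief_gt0 reg). Qed.

Let own_gt0 x : J x -> 0 < mkb M * x.
Proof. by move=> /(rp_gt0 reg) x0; rewrite mulr_gt0 ?mkb_gt0. Qed.

Let J_own x : J x -> forall m,
  k m x = best_emission (mkd M) (mkb M * [eta alpha with l |-> x] m) (s x) (K x)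
  /\ q x m = Num.max (s x) (k m x).
Proof.
move=> Jx; apply: equilibrium_best_emission => [m||m qm].
- rewrite /=; case: eqP => _; first exact: rp_gt0 reg _ Jx.
  exact: rp_belief_gt0 reg m.
- exact: rp_equilibrium reg _ Jx.
- exact: rp_no_white reg _ m Jx qm.
Qed.

Let own_emission x : J x ->
  k l x = best_emission (mkd M) (mkb M * x) (s x) (K x).
Proof. by move=> /J_own /(_ l) [-> _]; rewrite /= eqxx. Qed.

Let rival_emission x m : J x -> m != l ->
  k m x = best_emission (mkd M) (t m) (s x) (K x).
Proof. by move=> /J_own /(_ m) [-> _] /negPf ml; rewrite /= ml. Qed.

Let output x m : J x -> q x m = Num.max (s x) (k m x).
Proof. by move=> /J_own /(_ m) []. Qed.

Let output_gt0 x m : J x -> 0 < q x m.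
Proof.
move=> Jx; have [_ qm _ _] := rp_equilibrium reg Jx m.
rewrite lt_neqAle qm andbT eq_sym; apply/eqP => qm0.
exact: rp_no_white reg _ m Jx qm0.
Qed.

Let emission_ge0 x m : J x -> 0 <= k m x.
Proof. by move=> /J_own /(_ m) [-> _]; exact: best_emission_ge0. Qed.

Let K_ge0 x : J x -> 0 <= K x.
Proof.
move=> Jx; rewrite /K /total_emission addr_ge0 ?mkKex_ge0// sumr_ge0// => m _.
exact: emission_ge0.
Qed.

Let state x : J x -> clears t (mkd M) (mkA M - mkc M - mkd M) (mkKex M) l
  (s x) (K x) (k l x).
Proof.
move=> Jx; split.
  rewrite -(output l Jx).
  have -> : rivals_output t (mkd M) l (s x) (K x) = \sum_(m < n | m != l) q x m.
    by apply: eq_bigr => m ml; rewrite output// rival_emission.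
  rewrite /s /margin (bigD1 l)//=; ring.
have -> : rivals_emission t (mkd M) l (s x) (K x) = \sum_(m < n | m != l) k m x.
  by apply: eq_bigr => m ml; rewrite rival_emission.
rewrite /K /total_emission (bigD1 l)//= /k /emission; ring.
Qed.

(** Direct effect of a change of the belief of firm [l], with margin and total
    emission frozen at their values for belief x. *)
Let response_gap x u :=
  best_emission (mkd M) (mkb M * u) (s x) (K x)
  - best_emission (mkd M) (mkb M * x) (s x) (K x).

(** Continuity of the equilibrium at x, end points of J included: no color is
    used. The constant adds 1 for s, n + 3 for K and 1 for k, from
    [clears_lipschitz]. *)
Let state_dist x u : J x -> J u ->
  `|s u - s x| + `|K u - K x| + `|k l u - k l x|
    <= (n%:R + 5%:R) * (2%:R * `|response_gap x u|).
Proof.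
move=> Jx Ju.
have key a b : J a -> J b -> k l b <= k l a ->
    `|s b - s a| + `|K b - K a| + `|k l b - k l a|
      <= (n%:R + 5%:R) * (k l a - k l b).
  move=> Ja Jb kk.
  have [ds dK] := clears_lipschitz t_gt0 (state Ja) (state Jb) kk.
  have KK := clears_emission_le t_gt0 (state Ja) (state Jb) kk.
  rewrite (distrC (s b)) (ler0_norm (x := K b - K a)) ?subr_le0//.
  rewrite (ler0_norm (x := k l b - k l a)) ?subr_le0//; lra.
have n5 : 0 < n%:R + 5%:R :> R by rewrite ltr_wpDl.
have [kk|/ltW kk] := leP (k l u) (k l x).
  apply: le_trans (key _ _ Jx Ju kk) _; rewrite ler_pM2l//.
  apply: le_trans (own_response_le_left t_gt0 (own_gt0 Ju) (state Jx) (state Ju)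
    (own_emission Jx) (own_emission Ju) kk) _.
  by rewrite ler_pM2l// /response_gap distrC ler_norm.
rewrite (distrC (s u)) (distrC (K u)) (distrC (k l u)).
apply: le_trans (key _ _ Ju Jx kk) _; rewrite ler_pM2l//.
apply: le_trans (own_response_le_right t_gt0 (own_gt0 Ju) (state Ju) (state Jx)
    (own_emission Ju) (own_emission Jx) kk) _.
by rewrite ler_pM2l// /response_gap ler_norm.
Qed.

Let choice_dist x u m : J x -> J u ->
  `|k m u - k m x| <= (n%:R + 5%:R) * (2%:R * `|response_gap x u|) /\
  `|q u m - q x m| <= 2%:R * ((n%:R + 5%:R) * (2%:R * `|response_gap x u|)).
Proof.
move=> Jx Ju; have h := state_dist Jx Ju.
have n1 := normr_ge0 (s u - s x); have n2 := normr_ge0 (K u - K x).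
have n3 := normr_ge0 (k l u - k l x).
have km : `|k m u - k m x| <= (n%:R + 5%:R) * (2%:R * `|response_gap x u|).
  have [->|ml] := eqVneq m l; first by lra.
  rewrite (rival_emission Ju ml) (rival_emission Jx ml).
  apply: le_trans (best_emission_dist _ _ _ _ _ (t_gt0 ml)) _; lra.
split=> //; rewrite (output m Ju) (output m Jx).
apply: le_trans (max_dist _ _ _ _) _; lra.
Qed.

Let response_gap_cvg x : J x ->
  `|response_gap x u| @[u --> within J (nbhs x)] --> (0 : R).
Proof.
move=> Jx; apply: cvg_within_filter.
suff : response_gap x u @[u --> x] --> (0 : R).
  by move=> /cvg_norm; rewrite normr0.
rewrite -(subrr (best_emission (mkd M) (mkb M * x) (s x) (K x))).
apply: cvgB; last exact: cvg_cst.
have := @best_emission_continuous R (mkd M) (s x) (K x) _ (own_gt0 Jx).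
have tax_cvg : mkb M * u @[u --> x] --> mkb M * x.
  by apply: cvgMr; exact: cvg_id.
exact: cvg_comp _ _ tax_cvg.
Qed.

Let cvg_of_dist (f : R -> R) (C x : R) : J x ->
  (forall u, J u -> `|f u - f x| <= C * `|response_gap x u|) ->
  f u @[u --> within J (nbhs x)] --> f x.
Proof.
move=> Jx h.
have bound : \forall u \near within J (nbhs x),
    0 <= `|f u - f x| <= C * `|response_gap x u|.
  by rewrite near_withinE; near=> u => Ju; rewrite normr_ge0; exact: h.
have gap0 : C * `|response_gap x u| @[u --> within J (nbhs x)] --> (0 : R).
  by rewrite -[0](mulr0 C); apply: cvgMr; exact: response_gap_cvg.
have zero : (fun=> 0) u @[u --> within J (nbhs x)] --> (0 : R).
  exact: cvg_cst.
have dist0 := squeeze_cvgr bound zero gap0.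
apply/subr_cvg0; apply: norm_cvg0; exact: dist0.
Unshelve. all: by end_near.
Qed.

Let emission_cvg m x : J x -> k m u @[u --> within J (nbhs x)] --> k m x.
Proof.
move=> Jx; apply: (cvg_of_dist (C := (n%:R + 5%:R) * 2%:R) Jx) => u Ju.
by rewrite -mulrA; have [] := choice_dist m Jx Ju.
Qed.

Let quantity_cvg m x : J x ->
  quantity q m u @[u --> within J (nbhs x)] --> quantity q m x.
Proof.
move=> Jx; apply: (cvg_of_dist (C := 2%:R * ((n%:R + 5%:R) * 2%:R)) Jx) => u Ju.
by rewrite -!mulrA; have [_] := choice_dist m Jx Ju.
Qed.

Let inner x : J° x -> J x := @interior_subset _ J x.

Let green_emission x m : J° x -> col m = green -> k m x = 0.
Proof.
by move=> Jx cm; have := rp_color reg m Jx; rewrite cm /k /emission => -[_ ->];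
  rewrite mul0r.
Qed.

Let orange_emission x m : J° x -> col m = orange -> 0 < k m x <= s x.
Proof.
move=> Jx cm; have := rp_color reg m Jx; rewrite cm => -[q0 /andP[r0 r1]].
have kq : k m x < q x m by rewrite /k /emission gtr_pMl.
have -> : 0 < k m x by rewrite /k /emission mulr_gt0.
move: kq; rewrite (output m (inner Jx)).
by rewrite lt_max ltxx orbF => /ltW.
Qed.

Let red_emission x m : J° x -> col m = red -> 0 < k m x /\ s x <= k m x.
Proof.
move=> Jx cm; have := rp_color reg m Jx; rewrite cm => -[q0 r1].
have kq : k m x = q x m by rewrite /k /emission r1 mul1r.
by rewrite kq; split => //; rewrite (output m (inner Jx)) le_max lexx.
Qed.

Let not_white x m : J° x -> col m <> white.
Proof.
move=> Jx cm; have := rp_color reg m Jx; rewrite cm.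
exact: rp_no_white reg _ _ (inner Jx).
Qed.

Let positive_emission x m : J° x -> col m <> green -> 0 < k m x.
Proof.
move=> Jx; case cm: (col m) => // _; first by case: (not_white Jx cm).
  by have /andP[] := orange_emission Jx cm.
by have [] := red_emission Jx cm.
Qed.

Section TwoBeliefs.
Variables (u v : R).
Hypotheses (Ju : J° u) (Jv : J° v) (uv : u < v).

Let tax_lt : mkb M * u < mkb M * v.
Proof. by rewrite ltr_pM2l ?mkb_gt0. Qed.

Let own_le : k l v <= k l u.
Proof.
exact: (own_emission_le (mkd_gt0 M) t_gt0 (own_gt0 (inner Ju))
  (own_gt0 (inner Jv)) (state (inner Ju)) (state (inner Jv))
  (own_emission (inner Ju)) (own_emission (inner Jv)) (K_ge0 (inner Ju))
  tax_lt).
Qed.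

Lemma own_emission_decreases : col l <> green -> k l v < k l u.
Proof.
move=> cl.
exact: (own_emission_lt (mkd_gt0 M) t_gt0 (own_gt0 (inner Ju))
  (own_gt0 (inner Jv)) (state (inner Ju)) (state (inner Jv))
  (own_emission (inner Ju)) (own_emission (inner Jv)) (K_ge0 (inner Ju)) tax_lt
  (positive_emission Ju cl)).
Qed.

Lemma own_output_nonincreasing : q v l <= q u l.
Proof.
rewrite (output l (inner Jv)) (output l (inner Ju)).
exact: (own_output_le t_gt0 (state (inner Ju)) (state (inner Jv)) own_le).
Qed.

Lemma green_belief : col l = green -> s u = s v /\ K u = K v.
Proof.
move=> cl; apply: (clears_unique t_gt0 (state (inner Ju)) (state (inner Jv))).
by rewrite !green_emission.
Qed.

Lemma red_belief : col l = red -> s u < s v /\ K v < K u.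
Proof.
move=> cl.
apply: (clears_red t_gt0 (state (inner Ju)) (state (inner Jv))).
- by have [] := red_emission Ju cl.
- by have [] := red_emission Jv cl.
- by apply: own_emission_decreases; rewrite cl.
Qed.

(** The first two claims are [clears_not_red]; for the third, a constant margin
    would force the other outputs to stay constant although K falls, which a red
    firm excludes. *)
Lemma orange_belief : col l = orange -> [/\ s v <= s u, K v < K u
  & (exists m, col m = red) -> s v < s u].
Proof.
move=> cl.
have [su Kuv sE] : [/\ s v <= s u, K v < K u & s v = s u ->
    rivals_output t (mkd M) l (s u) (K v)
    = rivals_output t (mkd M) l (s u) (K u)].
  apply: (clears_not_red t_gt0 (state (inner Ju)) (state (inner Jv))).
  - by have /andP[] := orange_emission Ju cl.
  - by have /andP[] := orange_emission Jv cl.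
  - by apply: own_emission_decreases; rewrite cl.
split=> // -[m cm]; rewrite lt_neqAle su andbT; apply/eqP => /sE outE.
have ml : m != l by apply/eqP => ml; move: cm; rewrite ml cl.
have [km sk] := red_emission Ju cm.
rewrite (rival_emission (inner Ju) ml) in km sk.
by have := rivals_output_lt t_gt0 ml Kuv sk km; rewrite outE ltxx.
Qed.

Lemma own_output_decreases :
  col l <> green -> (exists m, col m = red) -> q v l < q u l.
Proof.
move=> cl hr; rewrite (output l (inner Jv)) (output l (inner Ju)).
have kl := own_emission_decreases cl.
case cE: (col l) => //; first by case: (not_white Ju cE).
  have /andP[_ ks] := orange_emission Ju cE.
  have /andP[_ ks'] := orange_emission Jv cE.
  by have [_ _ /(_ hr)] := orange_belief cE; rewrite !max_l.
have [_ sk] := red_emission Ju cE; have [_ sk'] := red_emission Jv cE.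
by rewrite !max_r.
Qed.

Variable i : 'I_n.
Hypothesis il : i != l.

Lemma green_belief_rival : col l = green -> k i u = k i v /\ q u i = q v i.
Proof.
move=> /green_belief[sE KE].
rewrite (output i (inner Ju)) (output i (inner Jv)).
by rewrite (rival_emission (inner Ju) il) (rival_emission (inner Jv) il) sE KE.
Qed.

Let emission_rises_K : K v < K u -> 0 < k i u ->
  k i u < best_emission (mkd M) (t i) (s u) (K v).
Proof.
rewrite (rival_emission (inner Ju) il).
exact: best_emission_strict_K (t_gt0 il).
Qed.

(** Lower K and higher s both raise emission and output. *)
Lemma red_belief_rival : col l = red ->
  (col i <> green -> k i u < k i v) /\ q u i < q v i.
Proof.
move=> /red_belief[suv Kvu].
have kiv : best_emission (mkd M) (t i) (s u) (K v) <= k i v.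
  by rewrite (rival_emission (inner Jv) il) best_emission_homo ?t_gt0// ltW.
have klt : 0 < k i u -> k i u < k i v.
  by move=> k0; exact: lt_le_trans (emission_rises_K Kvu k0) kiv.
split; first by move=> ci; apply: klt; exact: positive_emission.
have qu := output_gt0 i (inner Ju).
have := emission_ge0 i (inner Ju); rewrite le_eqVlt => /predU1P[k0|k0].
  move: qu; rewrite (output i (inner Ju)) (output i (inner Jv)) -k0 => su0.
  rewrite lt_max; apply/orP; left; move: su0.
  by rewrite lt_max ltxx orbF => su0; rewrite max_l// ltW.
rewrite (output i (inner Ju)) (output i (inner Jv)) gt_max !lt_max suv klt//.
by rewrite orbT.
Qed.

(** The margin falls, but the emission of an orange firm depends on K alone, and
    the output of a green or orange firm is the margin. *)
Lemma orange_belief_rival : col l = orange -> col i <> red ->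
  [/\ col i <> green -> k i u < k i v, q v i <= q u i
    & (exists m, col m = red) -> q v i < q u i].
Proof.
move=> /orange_belief[suv Kvu sred] ci.
have margin_output x : J° x -> q x i = s x.
  move=> Jx; rewrite (output i (inner Jx)); have := not_white Jx (m := i).
  case cE: (col i) ci => // _ _.
    have := output_gt0 i (inner Jx); rewrite (output i (inner Jx)).
    rewrite (green_emission Jx cE) => s0; rewrite max_l//.
    by move: s0; rewrite lt_max ltxx orbF => /ltW.
  by rewrite max_l//; have /andP[] := orange_emission Jx cE.
rewrite (margin_output _ Ju) (margin_output _ Jv); split=> // cg.
have cE : col i = orange.
  by move: ci cg (not_white Ju (m := i)); case: (col i).
have mdlE x : J° x -> k i x = mkd M / t i - K x.
  move=> Jx; have := orange_emission Jx cE.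
  rewrite (rival_emission (inner Jx) il) => h.
  exact: best_emission_orange (t_gt0 il) h.
by rewrite (mdlE _ Ju) (mdlE _ Jv) ltrD2l ltrN2.
Qed.

End TwoBeliefs.

Let Jitv := rp_interval reg.

Lemma regime_own_belief :
  [/\ weakly_decreasing_on J (emission r q l),
      col l <> green -> strictly_decreasing_on J (emission r q l),
      weakly_decreasing_on J (quantity q l)
    & col l <> green -> (exists m, col m = red) ->
        strictly_decreasing_on J (quantity q l)].
Proof.
have kc := emission_cvg (m := l); have qc := quantity_cvg (m := l).
split.
- apply: weakly_decreasing_from_interior => // u v Ju Jv uv.
  have [cl|cl] := pselect (col l = green).
    by rewrite -/(k l v) -/(k l u) !green_emission.
  exact/ltW/own_emission_decreases.
- move=> cl; apply: strictly_decreasing_from_interior => // u v Ju Jv uv.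
  exact: own_emission_decreases.
- apply: weakly_decreasing_from_interior => // u v Ju Jv uv.
  exact: own_output_nonincreasing.
- move=> cl cr; apply: strictly_decreasing_from_interior => // u v Ju Jv uv.
  exact: own_output_decreases.
Qed.

Lemma regime_rival_belief i : l != i ->
  (col l = green ->
     constant_on J (emission r q i) /\ constant_on J (quantity q i)) /\
  (col l <> green -> ~ (col l = orange /\ col i = red) ->
     [/\ weakly_increasing_on J (emission r q i),
         col i <> green -> strictly_increasing_on J (emission r q i),
         col l = red -> strictly_increasing_on J (quantity q i),
         col l = orange -> weakly_decreasing_on J (quantity q i)
       & col l = orange -> (exists m, col m = red) ->
           strictly_decreasing_on J (quantity q i)]).
Proof.
rewrite eq_sym => il.
have kc := emission_cvg (m := i); have qc := quantity_cvg (m := i).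
split=> [cl|cl clci].
  split; apply: constant_from_interior => // u v Ju Jv uv.
    by have [] := green_belief_rival Ju Jv il cl.
  by have [] := green_belief_rival Ju Jv il cl.
have cired : col l = orange -> col i <> red by move=> c1 c2; apply: clci.
have rises u v : J° u -> J° v -> u < v -> col i <> green -> k i u < k i v.
  move=> Ju Jv uv ci; case cE: (col l) => //; first by case: (not_white Ju cE).
    by have [/(_ ci)] := orange_belief_rival Ju Jv uv il cE (cired cE).
  by have [/(_ ci)] := red_belief_rival Ju Jv uv il cE.
split.
- apply: weakly_increasing_from_interior => // u v Ju Jv uv.
  have [ci|ci] := pselect (col i = green).
    by rewrite -/(k i v) -/(k i u) !green_emission.
  exact/ltW/rises.
- move=> ci; apply: strictly_increasing_from_interior => // u v Ju Jv uv.
  exact: rises.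
- move=> cE; apply: strictly_increasing_from_interior => // u v Ju Jv uv.
  by have [] := red_belief_rival Ju Jv uv il cE.
- move=> cE; apply: weakly_decreasing_from_interior => // u v Ju Jv uv.
  by have [] := orange_belief_rival Ju Jv uv il cE (cired cE).
- move=> cE cr; apply: strictly_decreasing_from_interior => // u v Ju Jv uv.
  by have [_ _ /(_ cr)] := orange_belief_rival Ju Jv uv il cE (cired cE).
Qed.

End Regime.

(** * Ambiguity for a red firm facing an orange one *)

Lemma first_order_red (R : realType) (t d s K q : R) :
  s <= q -> d - t * (K + q) = q - s -> first_order_conditions t d s K q q.
Proof. by move=> sq taxE; split; rewrite ?taxE. Qed.

Lemma first_order_orange (R : realType) (t d s K k : R) :
  t * (K + k) = d -> first_order_conditions t d s K k s.
Proof. by move=> taxE; split; rewrite // taxE !subrr ?mul0r. Qed.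

Section Ambiguity.
Context {R : realType}.

(** With these constants A - c - d = 1, and an orange firm of belief x emits 1 /
    x - K; so s and K become affine functions of 1 / x. *)
Definition example_market : market R :=
  @Market R 3 1 1 1 0 (ltr0n _ 3) ltr01 ltr01 ltr01 (lexx 0).

(** The colors of both economies below are constant while the inverse y of the
    belief satisfies 21 / 23 < y < 1; here 20 / 21 <= y <= 50 / 51. *)
Definition example_interval : set R := `[51 / 50, 21 / 20]%classic.

Definition firms {n} (s : seq R) (m : 'I_n) : R := s`_m.

Lemma example_intervalE x : example_interval x ->
  [/\ 0 < x, x * x^-1 = 1 & 20 / 21 <= x^-1 <= 50 / 51].
Proof.
rewrite /example_interval/= in_itv/= => /andP[x1 x2].
have x0 : 0 < x by lra.
have xx : x * x^-1 = 1 by rewrite mulfV// gt_eqF.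
split=> //; apply/andP; split.
  by rewrite -(ler_pM2l x0) xx; lra.
by rewrite -(ler_pM2l x0) xx; lra.
Qed.

Lemma example_regime (n : nat) (alpha : 'I_n -> R) (l : 'I_n)
    (r q : R -> 'I_n -> R) (col : 'I_n -> color) :
  (forall m, 0 < alpha m) ->
  (forall x, example_interval x -> forall m, 0 < q x m /\
     has_color (col m) (r x m) (q x m)) ->
  (forall x, example_interval x -> forall m, first_order_conditions
     ([eta alpha with l |-> x] m) 1 (1 - \sum_(j < n) q x j)
     (\sum_(j < n) r x j * q x j) (r x m * q x m) (q x m)) ->
  regime_preserving example_market alpha l example_interval r q col.
Proof.
move=> a0 qcol foc; split=> //.
- exact: interval_is_interval.
- exists (51 / 50), (21 / 20).
  by split; rewrite /example_interval/= ?in_itv/= ?lexx//; lra.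
- by move=> x /example_intervalE[].
- move=> x Jx; have [x0 _ _] := example_intervalE Jx.
  apply: first_order_equilibrium.
  + by move=> m /=; case: eqP.
  + move=> m; have [q0] := qcol x Jx m; case: (col m) => /=.
    * by move=> qE; rewrite qE ltxx in q0.
    * by case=> _ ->; rewrite lexx ler01.
    * by case=> _ /andP[r0 r1]; rewrite !ltW.
    * by case=> _ ->; rewrite lexx ler01.
  + by move=> m; have [] := qcol x Jx m.
  + move=> m; have -> : margin example_market (q x) = 1 - \sum_(j < n) q x j.
      by rewrite /margin /=; congr (_ - _); ring.
    rewrite /total_emission /= add0r mul1r; exact: foc.
- by move=> x m Jx /= qm; have [] := qcol x Jx m; rewrite qm ltxx.
- by move=> x m /interior_subset Jx; have [] := qcol x Jx m.
Qed.

(** With y = 1 / x: the orange firm has emission y - K and output s, and the red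
    one solves q (1 + 1/9) = s + 1 - K / 9. Together with 2 s + q = 1 and 2 K =
    q + y this gives q = (27 - y) / 30, increasing in x. *)
Definition duopoly_output (x : R) : 'I_2 -> R :=
  let q := (27 - x^-1) / 30 in firms [:: q; (1 - q) / 2].

Definition duopoly_technology (x : R) : 'I_2 -> R :=
  let q := (27 - x^-1) / 30 in firms [:: 1; (x^-1 - q) / (1 - q)].

Definition red_orange_color (m : nat) : color :=
  if m == 1%N then orange else red.

Lemma duopoly_regime :
  regime_preserving example_market (firms [:: 9^-1; 1]) ord_max
    example_interval duopoly_technology duopoly_output
    (fun m => red_orange_color m).
Proof.
apply: example_regime => [m|x Jx|x Jx].
- by case: m => [[|[|m]] hm] //=; rewrite /firms /=; lra.
- have [x0 xy /andP[y1 y2]] := example_intervalE Jx.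
  rewrite /duopoly_technology /duopoly_output.
  move: (x^-1) xy y1 y2 => y xy y1 y2.
  case=> [[|[|m]] hm] //=; rewrite /firms /=; split; try lra.
  have s0 : 0 < 1 - (27 - y) / 30 by lra.
  have k0 : 0 < y - (27 - y) / 30 by lra.
  by split; [lra | rewrite divr_gt0//= ltr_pdivrMr//; lra].
- have [x0 xy /andP[y1 y2]] := example_intervalE Jx.
  rewrite !big_ord_recl !big_ord0.
  rewrite /duopoly_technology /duopoly_output.
  move: (x^-1) xy y1 y2 => y xy y1 y2.
  rewrite /firms /=.
  have kE : (y - (27 - y) / 30) / (1 - (27 - y) / 30)
      * ((1 - (27 - y) / 30) / 2) = (y - (27 - y) / 30) / 2.
    by field; rewrite gt_eqF//; lra.
  rewrite kE; case=> [[|[|m]] hm] //=; rewrite ?mul1r ?kE.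
    by apply: first_order_red; lra.
  have -> : 1 - ((27 - y) / 30 + ((1 - (27 - y) / 30) / 2 + 0))
     = (1 - (27 - y) / 30) / 2 by lra.
  apply: first_order_orange; rewrite -[RHS]xy; congr (_ * _); lra.
Qed.

Definition second_firm : 'I_3 := Ordinal (isT : (1 < 3)%N).

(** The duopoly with another red firm of belief 1. The four linear equations
    give s = (3 y - 1) / 40 and K = (21 + 17 y) / 40; as the belief 1/9 is
    smaller than 3/17, the change of s outweighs that of K / 9 in the output of
    the first firm. *)
Definition triopoly_output (x : R) : 'I_3 -> R :=
  firms [:: (33 + x^-1) / 40; (3 * x^-1 - 1) / 40; (9 - 7 * x^-1) / 40].

Definition triopoly_technology (x : R) : 'I_3 -> R :=
  firms [:: 1; (23 * x^-1 - 21) / (3 * x^-1 - 1); 1].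

Lemma triopoly_regime :
  regime_preserving example_market (firms [:: 9^-1; 1; 1]) second_firm
    example_interval triopoly_technology triopoly_output
    (fun m => red_orange_color m).
Proof.
apply: example_regime => [m|x Jx|x Jx].
- by case: m => [[|[|[|m]]] hm] //=; rewrite /firms /=; lra.
- have [x0 xy /andP[y1 y2]] := example_intervalE Jx.
  rewrite /triopoly_technology /triopoly_output.
  move: (x^-1) xy y1 y2 => y xy y1 y2.
  case=> [[|[|[|m]]] hm] //=; rewrite /firms /=; split; try lra.
  have s0 : 0 < 3 * y - 1 by lra.
  have k0 : 0 < 23 * y - 21 by lra.
  by split; [lra | rewrite divr_gt0//= ltr_pdivrMr//; lra].
- have [x0 xy /andP[y1 y2]] := example_intervalE Jx.
  rewrite !big_ord_recl !big_ord0.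
  rewrite /triopoly_technology /triopoly_output.
  move: (x^-1) xy y1 y2 => y xy y1 y2.
  rewrite /firms /=.
  have kE : (23 * y - 21) / (3 * y - 1) * ((3 * y - 1) / 40)
      = (23 * y - 21) / 40.
    by field; rewrite gt_eqF//; lra.
  rewrite kE.
  case=> [[|[|[|m]]] hm] //=; rewrite ?mul1r ?kE.
  + by apply: first_order_red; lra.
  + have -> : 1 - ((33 + y) / 40 + ((3 * y - 1) / 40 + ((9 - 7 * y) / 40 + 0)))
      = (3 * y - 1) / 40 by lra.
    by apply: first_order_orange; rewrite -[RHS]xy; congr (_ * _); lra.
  + by apply: first_order_red; lra.
Qed.

Let invr_lt x y : example_interval x -> example_interval y -> x < y ->
  y^-1 < x^-1.
Proof.
move=> /example_intervalE[x0 _ _] /example_intervalE[y0 _ _] xy.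
by rewrite ltf_pV2.
Qed.

Lemma duopoly_increasing :
  strictly_increasing_on example_interval
    (emission duopoly_technology duopoly_output ord0) /\
  strictly_increasing_on example_interval (quantity duopoly_output ord0).
Proof.
split=> x y /set_mem Jx /set_mem Jy xy; have := invr_lt Jx Jy xy;
  rewrite /emission /quantity /duopoly_technology /duopoly_output /firms /=;
  lra.
Qed.

Lemma triopoly_decreasing :
  strictly_decreasing_on example_interval
    (emission triopoly_technology triopoly_output ord0) /\
  strictly_decreasing_on example_interval (quantity triopoly_output ord0).
Proof.
split=> x y /set_mem Jx /set_mem Jy xy; have := invr_lt Jy Jx xy;
  rewrite /emission /quantity /triopoly_technology /triopoly_output /firms /=;
  lra.
Qed.

End Ambiguity.

Theorem theorem4p3 (R : realType) :
  (* (a) own belief *)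
  (forall (M : market R) (n : nat) (alpha : 'I_n -> R) (i : 'I_n) (J : set R)
      (r q : R -> 'I_n -> R) (col : 'I_n -> color),
    regime_preserving M alpha i J r q col ->
    [/\ weakly_decreasing_on J (emission r q i),
        col i <> green -> strictly_decreasing_on J (emission r q i),
        weakly_decreasing_on J (quantity q i)
      & col i <> green -> (exists m, col m = red) ->
          strictly_decreasing_on J (quantity q i)])
  /\
  (* (b)(i), (iii), (iv): belief of another firm *)
  (forall (M : market R) (n : nat) (alpha : 'I_n -> R) (i j : 'I_n) (J : set R)
      (r q : R -> 'I_n -> R) (col : 'I_n -> color),
    j != i ->
    regime_preserving M alpha j J r q col ->
    (col j = green ->
       constant_on J (emission r q i) /\ constant_on J (quantity q i))
    /\
    (col j <> green -> ~ (col j = orange /\ col i = red) ->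
       [/\ weakly_increasing_on J (emission r q i),
           col i <> green -> strictly_increasing_on J (emission r q i),
           col j = red -> strictly_increasing_on J (quantity q i),
           col j = orange -> weakly_decreasing_on J (quantity q i)
         & col j = orange -> (exists m, col m = red) ->
             strictly_decreasing_on J (quantity q i)]))
  /\
  (* (b)(ii): the two economies have the same constants, the same belief of the
     red firm i and the same interval for the belief of the orange firm j; they
     differ only in the other firms *)
  (exists (M : market R) (a : R) (J : set R),
    (exists (n : nat) (alpha : 'I_n -> R) (i j : 'I_n)
        (r q : R -> 'I_n -> R) (col : 'I_n -> color),
      [/\ j != i /\ alpha i = a,
          regime_preserving M alpha j J r q col,
          col j = orange /\ col i = red,
          strictly_increasing_on J (emission r q i)
        & strictly_increasing_on J (quantity q i)])
    /\
    (exists (n : nat) (alpha : 'I_n -> R) (i j : 'I_n)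
        (r q : R -> 'I_n -> R) (col : 'I_n -> color),
      [/\ j != i /\ alpha i = a,
          regime_preserving M alpha j J r q col,
          col j = orange /\ col i = red,
          strictly_decreasing_on J (emission r q i)
        & strictly_decreasing_on J (quantity q i)])).
Proof.
split.
  by move=> M n alpha i J r q col reg; exact: (regime_own_belief reg).
split=> [M n alpha i j J r q col ji reg|].
  exact: (regime_rival_belief reg ji).
exists example_market, 9^-1, example_interval; split.
  have [inc1 inc2] := @duopoly_increasing R.
  exists 2%N, (@firms R 2 [:: 9^-1; 1]), (ord0 : 'I_2), (ord_max : 'I_2).
  exists duopoly_technology, duopoly_output.
  exists (fun m : 'I_2 => red_orange_color m).
  by split=> //; exact: duopoly_regime.
have [dec1 dec2] := @triopoly_decreasing R.
exists 3%N, (@firms R 3 [:: 9^-1; 1; 1]), (ord0 : 'I_3), second_firm.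
exists triopoly_technology, triopoly_output.
exists (fun m : 'I_3 => red_orange_color m).
by split=> //; exact: triopoly_regime.
Qed.
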